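(* Let $G$ be a finite solvable group of even order such that all Sylow subgroups of $G$ are nilpotent of nilpotency class at most $2$ and all Sylow $2$-subgroups of $G$ are abelian. Then $G$ is an IYB group.
   Context: A solution of the Yang--Baxter equation (YBE) means an involutive, non-degenerate, set-theoretic solution: a non-empty set $X$ with a map $r\colon X\times X\to X\times X$, $r(x,y)=(\sigma_x(y),\gamma_y(x))$, such that $r^2=\mathrm{id}$, all maps $\sigma_x,\gamma_y\colon X\to X$ are bijective, and $r_{12}r_{23}r_{12}=r_{23}r_{12}r_{23}$ on $X^3$, where $r_{12}=r\times\mathrm{id}_X$ and $r_{23}=\mathrm{id}_X\times r$. Its permutation group is $\mathcal{G}(X,r)=\langle \sigma_x\mid x\in X\rangle$. An involutive Yang--Baxter group (IYB group) is a finite group isomorphic to $\mathcal{G}(X,r)$ for some finite solution $(X,r)$ of the YBE. Equivalently (a known result), a finite group is an IYB group if and only if it is isomorphic to the multiplicative group of a finite left brace. A left brace is a set $B$ with two operations $+$ and $\circ$ such that $(B,+)$ is an abelian group, $(B,\circ)$ is a group (the multiplicative group), and $a\circ(b+c)+a=a\circ b+a\circ c$ for all $a,b,c\in B$. *)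

(* Defs.v *)
From mathcomp Require Import all_boot all_fingroup all_solvable.

Set Implicit Arguments.
Unset Strict Implicit.
Unset Printing Implicit Defensive.

Local Open Scope group_scope.

Section YangBaxter.

Variables (X : Type) (r : X * X -> X * X).

(* r (x, y) = (yb_sigma x y, yb_gamma y x) *)
Definition yb_sigma (x y : X) : X := (r (x, y)).1.
Definition yb_gamma (y x : X) : X := (r (x, y)).2.

Definition yb_r12 (t : X * X * X) : X * X * X :=
  let: (x, y, z) := t in (r (x, y), z).

Definition yb_r23 (t : X * X * X) : X * X * X :=
  let: (x, y, z) := t in let: (y', z') := r (y, z) in (x, y', z').

Record yb_solution : Prop := YBSolution {
  yb_nonempty : inhabited X;
  yb_involutive : involutive r;
  yb_sigma_bij : forall x, bijective (yb_sigma x);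
  yb_gamma_bij : forall y, bijective (yb_gamma y);
  yb_braid : forall t,
    yb_r12 (yb_r23 (yb_r12 t)) = yb_r23 (yb_r12 (yb_r23 t))
}.

End YangBaxter.

(* The product of {perm X} is composition in diagrammatic order. The subgroup
   generated by the sigma_x is the same set of permutations for either order
   of composition, and the two group laws are isomorphic by inversion. *)
Definition yb_permgroup (X : finType) (r : X * X -> X * X) : {group {perm X}} :=
  <<[set s : {perm X} | [exists x, [forall y, s y == yb_sigma r x y]]]>>%G.

Definition IYB_group (gT : finGroupType) (G : {group gT}) : Prop :=
  exists (X : finType) (r : X * X -> X * X),
    yb_solution r /\ G \isog yb_permgroup r.

(* Main.v *)
Require Import Defs.
From mathcomp Require Import all_boot all_fingroup all_solvable.
From mathcomp Require Import ssralg zmodp matrix mxrepresentation mxabelem.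
From Stdlib Require Ncring Ncring_tac.

Set Implicit Arguments.
Unset Strict Implicit.
Unset Printing Implicit Defensive.

Import GRing.Theory.
Local Open Scope group_scope.

(** A finite group is an IYB group as soon as it carries a bijective
    1-cocycle with values in an abelian group on which it acts. Such a
    cocycle is built one prime at a time.

    Fix a prime [p] and let [P] be a Sylow [p]-subgroup of [G]. The main
    point is that [G] has [p]-length one: the image of [P] in [G /
    'O_p^'(G)] is normal ([sylow_sub_pcore]). If ['O_p^'(G) = 1] then [V =
    'O_p(G)] contains its centralizer, which is enough when [P] is
    abelian. If [p] is odd, class at most two gives [[V, x, x] = 1] for
    [x] in [P]: the element [x] acts on [V / 'Phi(V)] as [1 + n] with [n ^
    2 = 0]. Hall and Higman would now bound the degree of the minimal
    polynomial of [x] from below, the exceptions being excluded by the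
    commutativity of the Sylow 2-subgroups. Class two allows a direct
    argument: an elementary computation with square-zero elements of a
    ring shows that [x] centralizes every [p']-group of class at most two
    that is abelian or of odd order, which it normalizes and which acts
    faithfully ([quadratic_cent]). So [P / V] centralizes ['F(G / V)] and
    is trivial.

    By the Schur-Zassenhaus theorem, [G / 'O_p^'(G)] is then a semidirect
    product of a copy of [P] by a [p']-group [H]. The group [P] has an
    addition that all its automorphisms preserve: its own product if [P]
    is abelian, and the Baer sum, which divides the product by a square
    root of the commutator, if [p] is odd. With respect to it the
    projection to [P] is a cocycle on [G / 'O_p^'(G)], whose fibres are
    the cosets of [H] ([baer_cocycle]). Pulled back to [G], it separates
    the cosets of a Hall [p']-subgroup. The product of these cocycles over
    all primes dividing the order of [G] is bijective.

    Finally, let [pi] be a bijective cocycle from [G] to [M]. On [M * G],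
    with [G] acting diagonally, let the point [(m, h)] act as the element
    of [G] that [pi] sends to [m]. This defines a solution of the
    Yang-Baxter equation ([cocycle_yb_solution]), whose permutation group
    is [G] because the action is faithful and every element of [G] occurs
    ([cocycle_IYB]). *)

(** * Quadratic elements in a ring *)

Section Quadratic.
Local Open Scope ring_scope.
Variables (R : pzRingType) (m : nat).
Hypothesis tf2 : forall z : R, z *+ 2 = 0 -> z = 0.
Hypothesis tfm : forall z : R, z *+ m = 0 -> z = 0.
Implicit Types u n a b c d : R.

(** These two instances make the normalization tactic for noncommutative rings
    available on [R]. *)
#[local] Instance ncring_ops :
  @Ncring.Ring_ops R 0 1 +%R *%R (fun x y => x - y) -%R eq := {}.

#[local] Instance ncring_axioms :
  @Ncring.Ring R 0 1 +%R *%R (fun x y => x - y) -%R eq ncring_ops.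
Proof.
constructor; try by move=> ? ? -> ? ? ->.
- exact: _.
- by move=> ? ? ->.
- exact: add0r.
- exact: addrC.
- exact: addrA.
- exact: mul1r.
- exact: mulr1.
- exact: mulrA.
- exact: mulrDl.
- by move=> *; apply: mulrDr.
- by [].
- exact: subrr.
Qed.

Ltac ncring := Ncring_tac.non_commutative_ring.

(** Let [d = n u - u n]. Since [d] commutes with [u], moving [n] across
    [u ^+ m = 1] produces [d u ^ (m - 1)] exactly [m] times, so it is zero. *)
Lemma comm_of_comm_commutator u n : u ^+ m = 1 ->
  u * (n * u - u * n) = (n * u - u * n) * u -> n * u = u * n.
Proof.
move=> um1; set d := n * u - u * n => ud.
have nu : n * u = u * n + d by rewrite /d; ncring.
have nX k : n * u ^+ k.+1 = u ^+ k.+1 * n + (d * u ^+ k) *+ k.+1.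
  elim: k => [|k IHk]; first by rewrite expr0 !expr1 mulr1.
  have dX : u ^+ k.+1 * d = d * u ^+ k.+1.
    by apply/esym/commrX; rewrite /GRing.comm ud.
  rewrite exprSr mulrA IHk mulrDl -(mulrA _ n u) nu mulrDr dX mulrA.
  by rewrite mulrnAl -(mulrA d) -[u ^+ k * u]exprSr -addrA -mulrS.
suffices d0 : d = 0 by rewrite nu d0 addr0.
case: m um1 tfm => [|k] um1 tf; first exact: tf.
have := nX k; rewrite um1 mulr1 mul1r => /eqP.
rewrite eq_sym addrC -subr_eq0 addrK => /eqP/tf du0.
by rewrite -[d]mulr1 -um1 exprSr mulrA du0 mul0r.
Qed.

Lemma unipotent_expr n k : n * n = 0 -> (1 + n) ^+ k = 1 + n *+ k.
Proof.
move=> n2; elim: k => [|k IHk]; first by rewrite addr0.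
rewrite exprSr IHk mulrDr mulr1 mulrDl mul1r mulrnAl n2 mul0rn addr0.
by rewrite -addrA -mulrSr.
Qed.

Lemma unipotent_torsion_eq1 c :
  (c - 1) * (c - 1) = 0 -> c ^+ m = 1 -> c = 1.
Proof.
move=> c2; rewrite -[in c ^+ m](subrK 1 c) (addrC _ 1) unipotent_expr //.
by rewrite -[RHS]addr0 => /addrI/tfm/subr0_eq.
Qed.

(** If [n * n = 0], the two elements that commute with [u] are the conjugates
    of [u] by [1 + n] and by its inverse [1 - n]. Their difference is twice the
    commutator of [u] and [n]: this is where 2 has to be regular. *)
Lemma comm_of_comm_conj n u : u ^+ m = 1 ->
  u * ((1 - n) * u * (1 + n)) = ((1 - n) * u * (1 + n)) * u ->
  u * ((1 + n) * u * (1 - n)) = ((1 + n) * u * (1 - n)) * u ->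
  n * u = u * n.
Proof.
move=> um1 cu1 cu2; apply: comm_of_comm_commutator => //.
apply: subr0_eq; apply: tf2; rewrite mulr2n.
transitivity (((1 - n) * u * (1 + n)) * u - ((1 - n) * u * (1 + n)) * u -
  (((1 + n) * u * (1 - n)) * u - ((1 + n) * u * (1 - n)) * u)); last first.
  by ncring.
by rewrite -{2}cu1 -{2}cu2; ncring.
Qed.

(** Here [x = 1 + n] and [x' = 1 + n'] are conjugate quadratic elements,
    [a = x^-1 x'] is a commutator, and [b] is the conjugate of [a] by [x]; the
    primes denote inverses. The sum [a + a^-1], which would be the trace of [a]
    in SL(2), commutes with [n], so [a + a^-1 = b + b^-1]. If [a b = c b a]
    with [c] central, then [(c - 1) (c a^2 - 1) = 0]: away from the fixed
    points of [c], the element [a^2] equals [c^-1], hence is central, and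
    oddness of the order forces [c = 1]. *)
Lemma quadratic_conj_comm n n' a a' b b' c :
    n * n = 0 ->
    a = (1 - n) * (1 + n') -> a' = (1 - n') * (1 + n) ->
    b = (1 - n) * a * (1 + n) -> b' = (1 - n) * a' * (1 + n) ->
    a * a' = 1 -> a' * a = 1 -> b * b' = 1 -> b' * b = 1 ->
    a * b = c * (b * a) -> c * a = a * c -> c * b = b * c ->
    c ^+ m = 1 -> odd m ->
  a * b = b * a.
Proof.
move=> n2 Da Da' Db Db' aa' a'a bb' b'b abc ca cb cm1 m_odd.
suffices c1 : c = 1 by rewrite abc c1 mul1r.
(* a + a' = 2 - (n n' + n' n) commutes with n, so the conjugation that maps *)
(* a to b fixes it.                                                         *)
have tb : a + a' = b + b'.
  have Dt : a + a' = 1 + 1 - (n * n' + n' * n) by rewrite Da Da'; ncring.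
  transitivity ((1 - n) * (a + a') * (1 + n)); last first.
    by rewrite Db Db'; ncring.
  have nt : n * (a + a') = (a + a') * n.
    transitivity (n + n - n * n' * n - n * n * n'); first by rewrite Dt; ncring.
    transitivity (n + n - n * n' * n - n' * (n * n)); last first.
      by rewrite Dt; ncring.
    by rewrite n2 mul0r mulr0.
  have -> : (1 - n) * (a + a') * (1 + n) =
      (a + a') + ((a + a') * n - n * (a + a')) - n * ((a + a') * n) by ncring.
  by rewrite -nt mulrA n2 mul0r subrr subr0 addr0.
have bt : (a + a') * b = b * (a + a').
  by rewrite tb mulrDl mulrDr bb' b'b.
have ca' : c * a' = a' * c.
  transitivity (a' * a * (c * a')); first by rewrite a'a mul1r.
  by rewrite -mulrA (mulrA a c) -ca -!mulrA aa' mulr1.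
have ca'b : c * (a' * b) = b * a'.
  transitivity (a' * (c * (b * a)) * a').
    by rewrite -!mulrA aa' mulr1 !mulrA ca'.
  by rewrite -abc mulrA a'a mul1r.
have e1 : (c - 1) * (a * b) = (c - 1) * (b * a').
  apply/subr0_eq.
  transitivity (c * ((a + a') * b) - c * (b * (a + a'))
    - (c * (a' * b) - b * a') + (c * (b * a) - a * b)); first by ncring.
  by rewrite bt ca'b -abc !subrr !addr0.
have cb1 : (c - 1) * b = b * (c - 1) by rewrite mulrBl mulrBr cb mul1r mulr1.
have e2 : (c - 1) * (c * (a * a)) = c - 1.
  transitivity (b' * (b * (c - 1) * (c * a)) * a).
    by rewrite !mulrA b'b mul1r.
  rewrite -cb1 -(mulrA _ b) (mulrA b) -cb -(mulrA c) -abc e1.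
  rewrite (mulrA (c - 1)) cb1.
  by rewrite !mulrA b'b mul1r -mulrA a'a mulr1.
(* Commuting c - 1 = (c - 1) c a^2 past b, where a^2 b = c^2 b a^2, costs a *)
(* factor c^2.                                                              *)
have e3 : (c + 1) * ((c - 1) * (c - 1)) = 0.
  transitivity ((c * c * (c - 1) * b - (c - 1) * b) * b').
    transitivity ((c * c * (c - 1) - (c - 1)) * (b * b')); last by ncring.
    by rewrite bb' mulr1; ncring.
  suffices -> : c * c * (c - 1) * b = (c - 1) * b by rewrite subrr mul0r.
  have aab : a * (a * b) = c * c * (b * (a * a)).
    by rewrite abc (mulrA a c) -ca -(mulrA c) (mulrA a b) abc !mulrA.
  rewrite -{2}e2; transitivity ((c - 1) * c * (a * (a * b))); last first.
    by rewrite !mulrA.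
  rewrite aab.
  transitivity (c * c * ((c - 1) * (c * b)) * (a * a)); last by ncring.
  transitivity (c * c * ((c - 1) * b) * (c * (a * a))).
    by rewrite cb1 -!mulrA e2 -cb1 !mulrA.
  by rewrite cb !mulrA.
(* c has odd order, so c + 1 cannot kill anything: c z = - z would give     *)
(* z = c^m z = - z.                                                         *)
apply: unipotent_torsion_eq1 => //; set z := (c - 1) * (c - 1) in e3 *.
have cz : c * z = - z.
  by apply/eqP; rewrite -subr_eq0 opprK -{2}[z]mul1r -mulrDl e3.
have cXz k : c ^+ k * z = (-1) ^+ k * z.
  elim: k => [|k IHk]; first by rewrite !expr0.
  by rewrite exprSr -mulrA cz mulrN IHk exprS mulN1r mulNr.
apply: tf2; rewrite mulr2n -{1}[z]mul1r -cm1 cXz -signr_odd m_odd.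
by rewrite expr1 mulN1r addNr.
Qed.
End Quadratic.

(** * Quadratic action of a p-element on a p'-group *)

Lemma coprime_torsion_free (V : zmodType) p k :
    p > 0 -> coprime p k -> (forall z : V, z *+ p = 0)%R ->
  forall z : V, (z *+ k = 0 -> z = 0)%R.
Proof.
move=> p_gt0 co_pk Vp z zk.
case: (egcdnP k p_gt0) => a b Dab _; rewrite (eqP co_pk) in Dab.
have: (z *+ (a * p) = 0)%R by rewrite mulnC mulrnA Vp mul0rn.
by rewrite Dab mulrnDr mulnC mulrnA zk mul0rn add0r.
Qed.

(** [rho] is a linear representation in characteristic [p] in which the
    element [x] acts quadratically; it is kept abstract as a map to a ring. *)
Section QuadraticAction.

Variables (R : pzRingType) (p : nat) (gT : finGroupType).
Variables (N Q : {group gT}) (rho : gT -> R) (x : gT).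
Hypotheses (p_pr : prime p) (p_odd : odd p).
Hypothesis charR : forall z : R, (z *+ p = 0)%R.
Hypothesis rho1 : rho 1 = 1%R.
Hypothesis rhoM : {in N &, forall y z, rho (y * z) = (rho y * rho z)%R}.
Hypotheses (sQN : Q \subset N) (Nx : x \in N) (nQx : x \in 'N(Q)).
Hypothesis p'Q : p^'.-group Q.
Hypothesis rho_faithful : {in Q, forall y, rho y = 1%R -> y = 1}.
Hypothesis quad_x : ((rho x - 1) * (rho x - 1) = 0)%R.

Let tf k : coprime p k -> forall z : R, (z *+ k = 0 -> z = 0)%R.
Proof.
by move=> co_pk; apply: coprime_torsion_free co_pk charR; apply: prime_gt0.
Qed.
Let co_p2 : coprime p 2. Proof. by rewrite coprimen2. Qed.
Let co_pQ : coprime p #|Q|.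
Proof. by rewrite prime_coprime // -p'natE. Qed.
Let NQ y : y \in Q -> y \in N. Proof. exact: (subsetP sQN). Qed.
Let QJ y : y \in Q -> y ^ x \in Q. Proof. by move=> Qy; rewrite memJ_norm. Qed.
Let QJV y : y \in Q -> y ^ x^-1 \in Q.
Proof. by move=> Qy; rewrite memJ_norm ?groupV. Qed.

Let rhoX y k : y \in N -> rho (y ^+ k) = (rho y ^+ k)%R.
Proof.
move=> Ny; elim: k => [|k IHk]; first by rewrite rho1.
by rewrite expgS exprS rhoM ?groupX // IHk.
Qed.

Let rhoQ1 y : y \in Q -> (rho y ^+ #|Q| = 1)%R.
Proof.
move=> Qy; rewrite -rhoX ?NQ // -[RHS]rho1; congr (rho _).
by apply/eqP; rewrite -order_dvdn order_dvdG.
Qed.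

Let rho_inj : {in Q &, injective rho}.
Proof.
move=> y z Qy Qz eq_yz; apply/(mulIg z^-1); rewrite mulgV.
apply: rho_faithful; first by rewrite groupM ?groupV.
by rewrite rhoM ?groupV ?NQ // eq_yz -rhoM ?groupV ?NQ // mulgV.
Qed.

Let n := (rho x - 1)%R.
Let rho_x : rho x = (1 + n)%R. Proof. by rewrite addrC subrK. Qed.
Let rho_xV : rho x^-1 = (1 - n)%R.
Proof.
have e : ((1 + n) * (1 - n) = 1)%R.
  by rewrite mulrBr mulr1 mulrDl mul1r quad_x addr0 addrK.
transitivity (rho x^-1 * (rho x * (1 - n)))%R; first by rewrite rho_x e mulr1.
by rewrite mulrA -rhoM ?groupV // mulVg rho1 mul1r.
Qed.

Let rhoJ y : y \in N -> rho (y ^ x) = ((1 - n) * rho y * (1 + n))%R.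
Proof.
by move=> Ny; rewrite /conjg !rhoM ?groupM ?groupV // rho_x rho_xV mulrA.
Qed.
Let rhoJV y : y \in N -> rho (y ^ x^-1) = ((1 + n) * rho y * (1 - n))%R.
Proof.
by move=> Ny; rewrite /conjg invgK !rhoM ?groupM ?groupV // rho_x rho_xV mulrA.
Qed.

Let comm_rho y z : commute y z -> y \in N -> z \in N ->
  (rho y * rho z = rho z * rho y)%R.
Proof. by move=> cyz Ny Nz; rewrite -!rhoM // cyz. Qed.

Lemma quadratic_comm_conj y : y \in Q -> commute y (y ^ x) -> commute x y.
Proof.
move=> Qy cyyx; have Ny := NQ Qy.
have cyyxV : commute y (y ^ x^-1).
  by apply: (conjg_inj x); rewrite [LHS]conjMg [RHS]conjMg conjgKV cyyx.
suffices nu : (n * rho y = rho y * n)%R.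
  rewrite /commute [RHS]conjgC; congr (_ * _); apply: (rho_inj Qy (QJ Qy)).
  apply: esym; rewrite rhoJ // mulrDr mulr1 mulrBl mul1r nu.
  rewrite mulrBl -(mulrA (rho y)) quad_x mulr0 subr0.
  by rewrite subrK.
apply: (@comm_of_comm_conj _ #|Q|) (tf co_p2) (tf co_pQ) _ _ (rhoQ1 Qy) _ _.
  by rewrite -rhoJ //; apply: comm_rho => //; apply/NQ/QJ.
by rewrite -rhoJV //; apply: comm_rho => //; apply/NQ/QJV.
Qed.

Lemma quadratic_commutator_comm y :
    Q^`(1) \subset 'Z(Q) -> odd #|Q| -> y \in Q ->
  commute [~ x, y] ([~ x, y] ^ x).
Proof.
move=> Q'Z oddQ Qy; have Ny := NQ Qy; set h := [~ x, y].
have Qh : h \in Q by rewrite /h commgEr groupM ?QJ ?groupV.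
have Nh := NQ Qh; set k := h ^ x.
have Qk : k \in Q := QJ Qh; have Nk := NQ Qk.
pose g := [~ h^-1, k^-1].
have Zg : g \in 'Z(Q) by rewrite (subsetP Q'Z) // mem_commg ?groupV.
have [Qg cQg] := setIP Zg.
have Dg : h * k = g * (k * h).
  rewrite /g; move: (h) (k) => h1 k1.
  by rewrite /commg /conjg !invgK !mulgA !mulgKV.
apply: rho_inj; [exact: groupM | exact: groupM | ].
rewrite (rhoM Nh Nk) (rhoM Nk Nh).
pose n' := (rho y^-1 * n * rho y)%R.
have rho_xy : rho (x ^ y) = (1 + n')%R.
  rewrite /conjg !rhoM ?groupM ?groupV // rho_x mulrDl mulrDr mul1r.
  by rewrite -rhoM ?groupV // mulVg rho1 /n' mulrA.
have yVy : (rho y * rho y^-1 = 1)%R by rewrite -rhoM ?groupV // mulgV.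
have n'2 : (n' * n' = 0)%R.
  transitivity (rho y^-1 * (n * (rho y * rho y^-1) * n) * rho y)%R.
    by rewrite /n' !mulrA.
  by rewrite yVy mulr1 quad_x mulr0 mul0r.
have rho_xyV : rho (x ^ y)^-1 = (1 - n')%R.
  have e : ((1 + n') * (1 - n') = 1)%R.
    by rewrite mulrBr mulr1 mulrDl mul1r n'2 addr0 addrK.
  have Nxy : x ^ y \in N by rewrite groupJ.
  transitivity (rho (x ^ y)^-1 * (rho (x ^ y) * (1 - n')))%R.
    by rewrite rho_xy e mulr1.
  by rewrite mulrA -rhoM ?groupV // mulVg rho1 mul1r.
apply: (@quadratic_conj_comm _ #|Q| (tf co_p2) (tf co_pQ) n n' (rho h)
          (rho h^-1) (rho k) (rho k^-1) (rho g)) => //.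
- by rewrite /h commgEl rhoM ?groupV ?groupJ // rho_xV rho_xy.
- by rewrite /h commgEl invMg invgK rhoM ?groupV ?groupJ // rho_xyV rho_x.
- by rewrite rhoJ.
- by rewrite -conjVg rhoJ ?groupV.
- by rewrite -rhoM ?groupV // mulgV.
- by rewrite -rhoM ?groupV // mulVg.
- by rewrite -rhoM ?groupV // mulgV.
- by rewrite -rhoM ?groupV // mulVg.
- have Nkh : k * h \in N by exact: groupM.
  by rewrite -(rhoM Nh Nk) -(rhoM Nk Nh) -(rhoM (NQ Qg) Nkh) Dg.
- exact: comm_rho (centP cQg _ Qh) (NQ Qg) Nh.
- exact: comm_rho (centP cQg _ Qk) (NQ Qg) Nk.
- exact: rhoQ1.
Qed.

(** If [Q] is abelian, every element of [Q] commutes with its conjugates. If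
    [Q] has class two and odd order, [x] centralizes every [h = [~ x, y]] by
    the two previous lemmas; then [x ^ y = x * h] with [x] and [h] commuting,
    and comparing [p]-th powers gives [h ^+ p = 1], hence [h = 1]. *)
Lemma quadratic_cent :
  Q^`(1) \subset 'Z(Q) -> abelian Q || odd #|Q| -> x \in 'C(Q).
Proof.
move=> Q'Z /orP[abQ | oddQ]; apply/centP=> y Qy.
  by apply: quadratic_comm_conj => //; apply: (centsP abQ); rewrite ?QJ.
apply/commgP/eqP; set h := [~ x, y].
have Qh : h \in Q by rewrite /h commgEr groupM ?QJ ?groupV.
have cxh : commute x h.
  by apply: quadratic_comm_conj => //; apply: quadratic_commutator_comm.
have rho_xp : rho (x ^+ p) = 1%R.
  by rewrite rhoX // rho_x unipotent_expr // charR addr0.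
have hp1 : h ^+ p = 1.
  apply: rho_faithful; first exact: groupX.
  have Nh := NQ Qh; have Ny := NQ Qy.
  have : rho ((x ^ y) ^+ p) = 1%R.
    rewrite -conjXg /conjg !rhoM ?groupM ?groupX ?groupV // rho_xp mul1r.
    by rewrite -rhoM ?groupV // mulVg.
  have -> : x ^ y = x * h by rewrite /h commgEl mulKVg.
  by rewrite expgMn // rhoM ?groupX // rho_xp mul1r.
apply/eqP; rewrite -order_eq1 -dvdn1 -(eqP co_pQ) dvdn_gcd.
by rewrite order_dvdn hp1 eqxx order_dvdG.
Qed.

End QuadraticAction.

(** * Groups of p-length one *)

Lemma quadratic_cent_abelem gT p (E Q : {group gT}) x :
    odd p -> p.-abelem E -> p^'.-group Q -> Q \subset 'N(E) -> 'C_Q(E) = 1 ->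
    x \in 'N(E) -> x \in 'N(Q) -> {in E, forall v, [~ v, x, x] = 1} ->
    Q^`(1) \subset 'C(Q) -> abelian Q || odd #|Q| ->
  x \in 'C(Q).
Proof.
move=> p_odd abelE p'Q nEQ tiCQ Nx NQx Ex1 Q'C abel_odd.
have [E1 | ntE] := eqsVneq E 1.
  have Q1: Q :=: 1 by rewrite -tiCQ E1 cent1T setIT.
  by rewrite Q1 cent1T inE.
have [p_pr _ _] := pgroup_pdiv (abelem_pgroup abelE) ntE.
pose rG := abelem_repr abelE ntE (subxx 'N(E)).
have rVJ v y : y \in 'N(E) -> (rVabelem abelE ntE (v *m rG y)) =
  (rVabelem abelE ntE v) ^ y by apply: rVabelemJ.
apply: (@quadratic_cent _ p _ 'N(E) Q rG) => //.
- by move=> z; rewrite -scaler_nat (pcharf0 (pchar_Fp p_pr)) scale0r.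
- exact: repr_mx1.
- exact: repr_mxM.
- move=> y Qy rGy1; suffices: y \in 'C_Q(E) by rewrite tiCQ => /set1P.
  have: y \in rker rG by apply/rkerP; rewrite (subsetP nEQ).
  by rewrite rker_abelem !inE Qy => /andP[].
- apply/row_matrixP=> i; rewrite row0 rowE.
  move: (delta_mx _ i) => u.
  apply: (@rVabelem_inj _ _ _ abelE ntE); rewrite rVabelem0.
  have rJ v : rVabelem abelE ntE (v *m (rG x - 1)%R) =
      [~ rVabelem abelE ntE v, x].
    rewrite mulmxBr mulmx1 rVabelemD rVabelemN rVJ // commgEl.
    apply: (centsP (abelem_abelian abelE)); last by rewrite groupV mem_rVabelem.
    by rewrite memJ_norm // mem_rVabelem.
  rewrite -mulmxE mulmxA !rJ.
  by rewrite Ex1 // mem_rVabelem.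
- by rewrite subsetI der_sub.
Qed.

(** Otherwise ['C_G('F(G))] would contain a normal subgroup [L] of [G], not
    inside ['F(G)], that is abelian modulo ['Z('F(G))]. As [L] centralizes
    ['Z('F(G))], it is nilpotent of class two, hence is inside ['F(G)]. *)
Lemma cent_sub_Fitting gT (G : {group gT}) :
  solvable G -> 'C_G('F(G)) \subset 'F(G).
Proof.
move=> solG; set C := 'C_G('F(G)); set Z := C :&: 'F(G).
have nsCG : C <| G.
  by rewrite /normal subsetIl normsI ?normG ?norms_cent ?gFnorm.
have nsZG : Z <| G by rewrite normalI ?Fitting_normal.
have [sCG nCG] := andP nsCG; have [sZG nZG] := andP nsZG.
have [CZ1 | ntCZ] := eqVneq (C / Z) 1.
  have: C \subset Z.
    by rewrite -quotient_sub1 ?CZ1 // (subset_trans sCG).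
  by rewrite subsetI => /andP[].
have [M [sMC nsMG ntM /is_abelemP[p _ /abelem_abelian abM]]] :=
  solvable_norm_abelem (quotient_sol _ (solvableS sCG solG))
    (quotient_normal _ nsCG) ntCZ.
case/negP: ntM; have [L defM sZL nsLG] := inv_quotientN nsZG nsMG.
have nZL := subset_trans (normal_sub nsLG) nZG.
have sLC : L \subset C.
  by rewrite -(quotientSGK nZL) ?subsetIl // -defM.
have sLF : L \subset 'F(G).
  apply: Fitting_max => //; apply: small_nil_class.
  apply: leq_trans (_ : 2 <= 5) => //.
  rewrite nil_class2 subsetI der_sub.
  have sL'Z : L^`(1) \subset Z by rewrite der1_min // -defM.
  apply: subset_trans sL'Z _; rewrite centsC (subset_trans sLC) //.
  by rewrite (subset_trans (subsetIr _ _)) // centS ?subsetIr.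
by rewrite defM -subG1 quotient_sub1 // subsetI sLC.
Qed.

(** Quantifying over all [q]-subgroups instead of the Sylow subgroups makes the
    condition visibly inherited by subgroups and quotients. *)
Definition class2_abelian2 gT (G : {group gT}) :=
  forall (q : nat) (S : {group gT}), prime q -> S \subset G -> q.-group S ->
    S^`(1) \subset 'C(S) /\ (q = 2 -> abelian S).

Lemma class2_abelian2_quotient gT (G N : {group gT}) :
  N <| G -> class2_abelian2 G -> class2_abelian2 (G / N).
Proof.
move=> /andP[sNG nNG] clG q S q_pr sSG qS.
have [P sylP] := Sylow_exists q G; have [sPG qP _] := and3P sylP.
have sylPN := quotient_pHall (subset_trans sPG nNG) sylP.
have [x _] := Sylow_Jsub sylPN sSG qS; rewrite sub_conjg => sSPx.
have [P'C abP] := clG q P q_pr sPG qP.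
have nNP := subset_trans sPG nNG.
split=> [|q2].
  apply: subset_trans (dergS 1 sSPx) (subset_trans _ (centS sSPx)).
  rewrite derJ centJ conjSg -quotient_der //.
  exact: quotient_cents.
by apply: abelianS sSPx _; rewrite abelianJ quotient_abelian ?abP.
Qed.

(** With [V = 'O_p(G)], solvability gives ['C_G(V) \subset V]; this settles
    the case where [P] is abelian, in particular [p = 2]. For odd [p], an
    element of [P] acts quadratically on [V], because [P] has class at most
    two. So [P / V] centralizes every ['O_q(G / V)] with [q] different from
    [p]; these generate ['F(G / V)], which contains its centralizer, and
    therefore [P / V] is trivial. *)
Lemma sylow_sub_pcore gT p (G P : {group gT}) :
    solvable G -> class2_abelian2 G -> prime p -> 'O_p^'(G) = 1 ->
  p.-Sylow(G) P -> P \subset 'O_p(G).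
Proof.
move=> solG clG p_pr p'G1 sylP; set V := 'O_p(G).
have [sPG pP _] := and3P sylP.
have sVP : V \subset P := pcore_sub_Hall sylP.
have nsVG : V <| G := pcore_normal _ _; have [sVG nVG] := andP nsVG.
have sCV : 'C_G(V) \subset V.
  by have := cent_sub_Fitting solG; rewrite (Fitting_eq_pcore p'G1).
have [P'C abP] := clG p P p_pr sPG pP.
have [p_even | p_odd] := even_prime p_pr.
  apply: subset_trans sCV; rewrite subsetI sPG centsC (subset_trans sVP) //.
  exact: abP.
have pV : p.-group V := pcore_pgroup _ _.
have nVP := subset_trans sPG nVG.
have Op1 : 'O_p(G / V) = 1 by apply: trivg_pcore_quotient.
set F := 'F(G / V).
have solGV : solvable (G / V) by apply: quotient_sol.
have p'F : p^'.-group F.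
  have /dprodP[_ defF _ _] := nilpotent_pcoreC p (Fitting_nil (G / V)).
  have <- : 'O_p^'(F) = F.
    by rewrite -[RHS]defF p_core_Fitting Op1 mul1g.
  exact: pcore_pgroup.
suffices cFP : P / V \subset 'C(F).
  have coPF := pnat_coprime (quotient_pgroup V pP) p'F.
  rewrite -quotient_sub1 // -(coprime_TIg coPF) subsetI subxx.
  apply: subset_trans (cent_sub_Fitting solGV).
  by rewrite subsetI quotientS.
rewrite centsC /F FittingEgen gen_subG; apply/bigcupsP=> -[q _] /= pi_q.
have q_pr : prime q by move: pi_q; rewrite mem_primes => /and3P[].
have [-> | q'p] := eqVneq q p; first by rewrite Op1 sub1G.
have [L defL sVL nsLG] := inv_quotientN nsVG (pcore_normal q (G / V)).
have [S sylS] := Sylow_exists q L; have [sSL qS _] := and3P sylS.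
have sSG := subset_trans sSL (normal_sub nsLG).
have nVL := subset_trans (normal_sub nsLG) nVG.
have nVS := subset_trans sSL nVL.
have p'S : p^'.-group S by apply: pi_pgroup qS _.
have coVS : coprime #|V| #|S| := pnat_coprime pV p'S.
have qLV : q.-group (L / V) by rewrite -defL pcore_pgroup.
have defSV : S / V = L / V.
  have sylSV := quotient_pHall nVS sylS.
  by apply/esym/(sub_pHall sylSV qLV); rewrite ?quotientS.
(* By the Frattini argument x may be replaced, modulo V, by an element y of *)
(* P that normalizes the Sylow q-subgroup S of L.                           *)
have defG : V * 'N_G(S) = G.
  have defL' : V * S = L.
    by apply/eqP; rewrite eqEsubset mul_subG //= -quotientSK // defSV.
  rewrite -{2}(Frattini_arg nsLG sylS) -defL' -mulgA; congr (_ * _).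
  by apply/esym/mulSGid; rewrite subsetI sSG normG.
rewrite defL -defSV centsC.
apply/subsetP=> _ /morphimP[x Nx Px ->] /=.
have: x \in V * 'N_G(S) by rewrite defG (subsetP sPG).
case/mulsgP=> v y Vv /setIP[Gy nSy] Dx.
have Py : y \in P by rewrite -(groupMl _ (subsetP sVP v Vv)) -Dx.
have -> : coset V x = coset V y.
  have NVv := subsetP nVG v (subsetP sVG v Vv).
  by rewrite Dx morphM ?(subsetP nVG y) //= (coset_id Vv) mul1g.
suffices cSy : y \in 'C(S).
  by rewrite (subsetP (quotient_cent _ _)) // mem_quotient.
set K := 'Phi(V).
have nsKG : K <| G by rewrite gFnormal_trans.
have [sKG nKG] := andP nsKG; have sKV : K \subset V := Phi_sub V.
have tiVS : V :&: S = 1 := coprime_TIg coVS.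
have nKS := subset_trans sSG nKG.
have NKy := subsetP nKG y Gy.
suffices : coset K y \in 'C(S / K).
  move=> cSKy; apply/centP=> s Ss; apply/commgP; rewrite -in_set1.
  have Sys : [~ y, s] \in S by rewrite commgEr groupM ?memJ_norm ?groupV.
  rewrite -[[set 1]]tiVS inE Sys andbT.
  have NKs := subsetP nKS s Ss.
  apply/(subsetP sKV)/coset_idr; first exact: groupR.
  by rewrite morphR //; apply/eqP/commgP/(centP cSKy); rewrite mem_quotient.
have [S'C abS] := clG q S q_pr sSG qS.
apply: (@quadratic_cent_abelem _ p (V / K)) => //.
- exact: Phi_quotient_abelem pV.
- exact: quotient_pgroup.
- by rewrite quotient_norms.
- have nKV := subset_trans sVG nKG.
  pose D := (S :&: coset K @*^-1 'C(V / K))%G.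
  have <- : D / K = 'C_(S / K)(V / K) by apply: morphim_setIpre.
  have sDS : D \subset S := subsetIl _ _.
  have cDVK : D / K \subset 'C(V / K).
    by rewrite [D / K]morphim_setIpre subsetIr.
  (* Coprime action: what centralizes V / 'Phi(V) centralizes V. *)
  have defVK : 'C_V(D) / K = V / K.
    rewrite coprime_norm_quotient_cent ?(subset_trans sDS) //.
    + by apply/setIidPl; rewrite centsC.
    + by rewrite (coprimeSg sKV) // (coprimegS sDS).
    + exact: solvableS (subset_trans sKV sVG) solG.
  have defV : 'C_V(D) = V.
    rewrite -[LHS]genGid; apply: Phi_nongen; apply/eqP.
    rewrite eqEsubset join_subG sKV subsetIl /=.
    apply: (@subset_trans _ _ (mem (K * 'C_V(D)))).
      by rewrite -quotientSK // defVK.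
    by rewrite mul_subG ?joing_subl ?joing_subr.
  have sDV : D \subset V.
    rewrite (subset_trans _ sCV) // subsetI (subset_trans sDS sSG) centsC.
    by rewrite -defV subsetIr.
  suffices -> : D = 1%G by rewrite quotient1.
  by apply/trivGP; rewrite -tiVS subsetI sDV.
- by rewrite (subsetP (quotient_norm _ _)) // mem_quotient // (subsetP nVG).
- by rewrite (subsetP (quotient_norm _ _)) // mem_quotient.
- move=> _ /morphimP[w Nw Vw ->].
  rewrite -!morphR ?groupR //=.
  have -> : [~ w, y, y] = 1; last by rewrite morph1.
  apply/eqP/commgP/(centP (subsetP P'C _ _) _ Py).
  by rewrite mem_commg // (subsetP sVP).
- by rewrite -quotient_der // quotient_cents.
- have [q2 | q_odd] := even_prime q_pr; first by rewrite quotient_abelian ?abS.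
  by apply/orP; right; apply: odd_pgroup_odd q_odd (quotient_pgroup _ qS).
Qed.

(** * From bijective cocycles to solutions of the Yang-Baxter equation *)

(** In a left brace with additive group [M], the identity map from the
    multiplicative group to [M] is a bijective 1-cocycle. The version here is
    relative to a subgroup [K]: [pi] identifies the cosets of [K] in [G] with
    [M]. Since [pi] is onto, [add] is determined by [pi] and [act], and
    commutativity and cancellation are the form in which the laws of an
    abelian group enter the Yang-Baxter equation. *)
Record cocycle_spec (gT : finGroupType) (G K : {group gT}) (M : finType)
    (add : M -> M -> M) (act : gT -> M -> M) (pi : gT -> M) : Prop :=
  CocycleSpec {
    cocycle_addC : commutative add;
    cocycle_addI : forall m, injective (add m);
    cocycle_act1 : forall m, act 1 m = m;
    cocycle_actM :
      {in G &, forall g h m, act (g * h) m = act g (act h m)};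
    cocycleM : {in G &, forall g h, pi (g * h) = add (pi g) (act g (pi h))};
    cocycle_surj : forall m, exists2 g, g \in G & pi g = m;
    cocycle_eq : {in G &, forall g h, pi g = pi h <-> g^-1 * h \in K}
  }.

Definition has_cocycle (gT : finGroupType) (G K : {group gT}) : Prop :=
  exists (M : finType) add act pi, @cocycle_spec gT G K M add act pi.

Section Solution.

Variables (gT : finGroupType) (G : {group gT}) (M : finType).
Variables (add : M -> M -> M) (act : gT -> M -> M) (pi : gT -> M).
Hypothesis coc : cocycle_spec G 1%G add act pi.

Definition cocycle_inv m := odflt 1 [pick g in G | pi g == m].

Lemma cocycle_invP m : cocycle_inv m \in G /\ pi (cocycle_inv m) = m.
Proof.
rewrite /cocycle_inv; case: pickP => [g /andP[Gg /eqP]// | no_g].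
by have [g Gg pi_g] := cocycle_surj coc m; case/andP: (no_g g); rewrite pi_g.
Qed.

Lemma cocycle_inj : {in G &, injective pi}.
Proof.
move=> g h Gg Gh /= /(cocycle_eq coc Gg Gh)/set1P/(canRL (mulKVg g)) ->.
by rewrite mulg1.
Qed.

Let X := (M * gT)%type.
Implicit Types x y z : X.
Definition diag_act (g : gT) (x : X) : X := (act g x.1, g * x.2).
Definition label (x : X) := cocycle_inv x.1.

Lemma label_in x : label x \in G. Proof. by case: (cocycle_invP x.1). Qed.
Lemma pi_label x : pi (label x) = x.1. Proof. by case: (cocycle_invP x.1). Qed.

Lemma diag_actM g h x :
  g \in G -> h \in G -> diag_act (g * h) x = diag_act g (diag_act h x).
Proof. by move=> Gg Gh; rewrite /diag_act (cocycle_actM coc) // mulgA. Qed.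

Lemma diag_actK g : g \in G -> cancel (diag_act g) (diag_act g^-1).
Proof.
move=> Gg [m h]; rewrite -diag_actM ?groupV // mulVg /diag_act.
by rewrite (cocycle_act1 coc) mul1g.
Qed.

Lemma diag_actVK g : g \in G -> cancel (diag_act g^-1) (diag_act g).
Proof. by move=> Gg x; rewrite -{1}[g]invgK diag_actK ?groupV. Qed.

(** The solution lives on [M * gT] rather than on [M] because the action of
    [G] on [M] may have a kernel; the regular factor makes it faithful. A point
    acts through the element of [G] that corresponds to its first component. *)
Definition cocycle_yb (t : X * X) : X * X :=
  let: (x, y) := t in
  let u := diag_act (label x) y in (u, diag_act (label u)^-1 x).
Local Notation r := cocycle_yb.

(** Both products are sent by [pi] to the sum of the first components of [x]
    and of [(r (x, y)).1], so this is commutativity of [add]. *)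
Lemma label_yb x y :
  label (r (x, y)).1 * label (r (x, y)).2 = label x * label y.
Proof.
set u := (r (x, y)).1; set v := (r (x, y)).2.
have pi_labelM (a b : X) :
    pi (label a * label b) = add a.1 (diag_act (label a) b).1.
  by rewrite (cocycleM coc) ?label_in // !pi_label.
apply: cocycle_inj; rewrite ?groupM ?label_in // !pi_labelM.
by rewrite [diag_act (label u) v]diag_actVK ?label_in // (cocycle_addC coc).
Qed.

Lemma cocycle_yb_involutive : involutive r.
Proof.
move=> [x y]; rewrite /= diag_actVK ?label_in //.
by rewrite diag_actK ?label_in.
Qed.

(** The guitar map conjugates [yb_r12] and [yb_r23] to the two adjacent
    transpositions of three letters, which satisfy the braid relation. *)
Definition guitar (t : X * X * X) : X * X * X :=
  let: (x, y, z) := t in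
  (x, diag_act (label x) y, diag_act (label x * label y) z).

Lemma guitar_inj : injective guitar.
Proof.
move=> [[x y] z] [[x' y'] z'] eq_t.
have ex : x = x' := congr1 (fun t => t.1.1) eq_t.
have /= := congr1 (fun t => t.1.2) eq_t.
rewrite -ex => /(can_inj (diag_actK (label_in x))) ey.
have /= := congr1 snd eq_t; rewrite -ex -ey => /(can_inj (diag_actK _)) -> //.
by rewrite groupM ?label_in.
Qed.

Lemma guitar_r12 t :
  guitar (yb_r12 r t) = let: (a, b, c) := guitar t in (b, a, c).
Proof.
case: t => [[x y] z]; rewrite /guitar /yb_r12 /=.
have := label_yb x y => /= ->.
by rewrite diag_actVK ?label_in.
Qed.

Lemma guitar_r23 t :
  guitar (yb_r23 r t) = let: (a, b, c) := guitar t in (a, c, b).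
Proof.
case: t => [[x y] z]; rewrite /guitar /yb_r23 /=.
by rewrite !diag_actM ?label_in // diag_actVK ?label_in.
Qed.

(** Since [pi] maps the inverse of [label x] to the additive inverse of the
    first component of [diag_act (label x)^-1 x], the latter determines
    [label x]. *)
Lemma diag_actV_label_inj : injective (fun x => diag_act (label x)^-1 x).
Proof.
move=> x y /= eq_xy.
have piV a : add (pi (label a)^-1) (diag_act (label a)^-1 a).1 = pi 1.
  rewrite /= -[in RHS](mulVg (label a)) (cocycleM coc) ?groupV ?label_in //.
  by rewrite pi_label.
have eq_label : label x = label y.
  apply/invg_inj/cocycle_inj; rewrite ?groupV ?label_in //.
  apply: (cocycle_addI coc (m := (diag_act (label x)^-1 x).1)).
  by rewrite !(cocycle_addC coc (diag_act _ _).1) piV eq_xy piV.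
by apply: (can_inj (diag_actVK (label_in x))); rewrite eq_xy eq_label.
Qed.

(** By [label_yb], [y] and the second component of [r (x, y)] determine
    [diag_act (label x)^-1 x]. *)
Lemma cocycle_gamma_inj y : injective (yb_gamma r y).
Proof.
move=> x x'; rewrite /yb_gamma /= => eq_v; apply: diag_actV_label_inj => /=.
have backE a (v := (r (a, y)).2) :
    diag_act (label a)^-1 a = diag_act (label y * (label v)^-1) v.
  have -> : label y * (label v)^-1 = (label a)^-1 * label (r (a, y)).1.
    by apply: (canLR (mulgK _)); rewrite -mulgA label_yb mulKg.
  rewrite diag_actM ?groupV ?label_in //.
  by rewrite [diag_act (label (r (a, y)).1) _]diag_actVK ?label_in.
by rewrite !backE /= eq_v.
Qed.

Lemma cocycle_yb_solution : yb_solution r.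
Proof.
split.
- have [g _ _] := cocycle_surj coc (pi 1); exact: (inhabits (pi 1, 1)).
- exact: cocycle_yb_involutive.
- move=> x; exists (diag_act (label x)^-1) => y; rewrite /yb_sigma /=.
    by rewrite diag_actK ?label_in.
  by rewrite diag_actVK ?label_in.
- by move=> y; apply: injF_bij; apply: cocycle_gamma_inj.
- move=> t; apply: guitar_inj.
  rewrite !(guitar_r12, guitar_r23).
  by case: (guitar t) => [[a b] c].
Qed.

Fact diag_perm_subproof g :
  injective (fun x => if g \in G then diag_act g^-1 x else x).
Proof.
by case Gg: (g \in G) => [|x y //]; exact: (can_inj (diag_actVK Gg)).
Qed.

(** The inverse turns the left action of [G] into a morphism for the
    diagrammatic product of permutations; the identity serves as the value
    outside [G], where [diag_act] need not be injective. *)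
Definition diag_perm g := perm (@diag_perm_subproof g).

Lemma diag_permE g x : g \in G -> diag_perm g x = diag_act g^-1 x.
Proof. by move=> Gg; rewrite permE Gg. Qed.

Lemma diag_permM : {in G &, {morph diag_perm : g h / g * h}}.
Proof.
move=> g h Gg Gh; apply/permP=> x.
by rewrite permM !diag_permE ?groupM // invMg diag_actM ?groupV.
Qed.
Canonical diag_perm_morphism := Morphism diag_permM.

Lemma diag_perm_injm : 'injm diag_perm.
Proof.
apply/injmP=> g h Gg Gh /permP/(_ (pi 1, 1))/(congr1 snd).
by rewrite !diag_permE //= !mulg1 => /invg_inj.
Qed.

Lemma cocycle_permgroup : yb_permgroup r = diag_perm @* G :> {set _}.
Proof.
rewrite /= -[RHS]genGid; congr <<_>>; apply/setP=> s; rewrite inE.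
apply/existsP/morphimP=> [[x /forallP sx] | [g Gg _ ->]].
  exists (label x)^-1; rewrite ?groupV ?label_in //.
  apply/permP=> y; rewrite diag_permE ?groupV ?label_in // invgK.
  exact/eqP/sx.
exists (pi g^-1, 1); apply/forallP=> y; rewrite diag_permE //.
suffices label_g : label (pi g^-1, 1) = g^-1 by rewrite /yb_sigma /= label_g.
by apply: cocycle_inj; rewrite ?groupV ?label_in // pi_label.
Qed.

Lemma cocycle_IYB : IYB_group G.
Proof.
exists X, r; split; first exact: cocycle_yb_solution.
by rewrite cocycle_permgroup sub_isog ?diag_perm_injm.
Qed.
End Solution.

(** * The Baer addition on a group of class two *)

Section Baer.

Variables (gT : finGroupType) (P : {group gT}) (k : nat).
Hypothesis P'C : P^`(1) \subset 'C(P).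
Hypothesis half :
  {in P &, forall a b, [~ a, b] ^+ k * [~ a, b] ^+ k = [~ a, b]}.

(** The exponent [k] plays the role of 1/2: the Baer sum of [a] and [b] is
    usually written as their product divided by a square root of their
    commutator. *)
Definition baer_add (a b : gT) := a * b * [~ b, a] ^+ k.
Definition baer_lambda (a b : gT) := b * [~ a, b] ^+ k.

Let cR a b c : a \in P -> b \in P -> c \in P -> commute [~ a, b] c.
Proof.
by move=> Pa Pb Pc; apply: (centP (subsetP P'C _ (mem_commg Pa Pb))).
Qed.

Let commM a b c : a \in P -> b \in P -> c \in P ->
  [~ a * b, c] = [~ a, c] * [~ b, c].
Proof. by move=> Pa Pb Pc; rewrite commMgJ conjgE (cR Pa Pc Pb) mulKg. Qed.

Let commR a b c d i : a \in P -> b \in P -> c \in P -> d \in P ->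
  [~ a * [~ b, c] ^+ i, d] = [~ a, d].
Proof.
move=> Pa Pb Pc Pd; rewrite commM ?groupX ?groupR //.
suffices /eqP-> : [~ [~ b, c] ^+ i, d] == 1 by rewrite mulg1.
by apply/commgP/commute_sym/commuteX/commute_sym/cR.
Qed.

Let commRr a b c d i : a \in P -> b \in P -> c \in P -> d \in P ->
  [~ d, a * [~ b, c] ^+ i] = [~ d, a].
Proof. by move=> Pa Pb Pc Pd; rewrite -invg_comm commR // invg_comm. Qed.

Lemma baer_add_in : {in P &, forall a b, baer_add a b \in P}.
Proof. by move=> a b Pa Pb; rewrite !groupM ?groupX ?groupR. Qed.

Lemma baer_lambda_in : {in P &, forall a b, baer_lambda a b \in P}.
Proof. by move=> a b Pa Pb; rewrite groupM ?groupX ?groupR. Qed.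

Lemma baer_addC : {in P &, commutative baer_add}.
Proof.
move=> a b Pa Pb; rewrite /baer_add [a * b]commgC -mulgA; congr (_ * _).
by rewrite -[in X in X * _]half // -(invg_comm a b) expgVn mulgK.
Qed.

Lemma baer_addI :
  {in P & &, forall a b c, baer_add a b = baer_add a c -> b = c}.
Proof.
move=> a b c Pa Pb Pc; rewrite /baer_add -!mulgA => /mulgI eq_bc.
have eqR : [~ b, a] = [~ c, a].
  by rewrite -(commR k Pb Pb Pa Pa) eq_bc commR.
by move: eq_bc; rewrite eqR => /mulIg.
Qed.

Lemma baer_addM : {in P &, forall a b, a * b = baer_add a (baer_lambda a b)}.
Proof.
move=> a b Pa Pb; rewrite /baer_add /baer_lambda commR // -(invg_comm a b).
by rewrite expgVn -!mulgA mulgV mulg1.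
Qed.

Lemma baer_lambdaM :
  {in P & &, forall a b c,
     baer_lambda (a * b) c = baer_lambda a (baer_lambda b c)}.
Proof.
move=> a b c Pa Pb Pc; rewrite /baer_lambda commRr // commM // expgMn.
  rewrite -mulgA; congr (_ * _).
  apply/commuteX/commute_sym/commuteX/commute_sym.
  by apply: cR; rewrite ?groupR.
by apply: cR; rewrite ?groupR.
Qed.

Lemma baer_lambdaJ a b c : baer_lambda a b ^ c = baer_lambda (a ^ c) (b ^ c).
Proof. by rewrite /baer_lambda conjMg conjXg conjRg. Qed.

Lemma baer_lambda1 b : baer_lambda 1 b = b.
Proof. by rewrite /baer_lambda comm1g expg1n mulg1. Qed.

(** The Baer sum is defined from the group law alone, so the complement [H]
    acts on it by automorphisms. Hence [g = a * h], with [a] in [P] and [h] in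
    [H], acts on [P] by conjugation by [h] followed by [baer_lambda a], and
    the cocycle is the projection to [a]. *)
Lemma baer_cocycle (G H : {group gT}) : P ><| H = G -> has_cocycle G H.
Proof.
case/sdprod_context=> nsPG sHG defG nPH tiPH.
have inPH g : g \in G -> g \in P * H by rewrite defG.
pose q g := divgr P H g; pose t g := remgr P H g.
have Pq g : g \in G -> q g \in P by move/inPH/mem_divgr.
have Ht g : g \in G -> t g \in H by move/inPH/mem_remgr.
have JP h a : h \in H -> a \in P -> a ^ h \in P.
  by move=> Hh; rewrite memJ_norm // (subsetP nPH).
have tM : {in G &, {morph t : g h / g * h}}.
  by apply: remgrM => //; apply/complP.
have Eg g : g = q g * t g by apply: divgr_eq.
have qM : {in G &, forall g h, q (g * h) = q g * q h ^ (t g)^-1}.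
  move=> g h Gg Gh.
  have -> : g * h = (q g * q h ^ (t g)^-1) * (t g * t h).
    rewrite {1}(Eg g) {1}(Eg h); move: (q g) (q h) (t g) (t h) => a b c d.
    by rewrite conjgE invgK !mulgA mulgKV.
  apply: (divgrMid tiPH); last by rewrite groupM ?Ht.
  by rewrite groupM ?(Pq g Gg) ?JP ?(Pq h Gh) ?groupV ?Ht.
have q1 : q 1 = 1 by rewrite /q divgr_id.
have t1 : t 1 = 1 by rewrite /t remgr1.
exists (subg_of P).
exists (fun a b => subg P (baer_add (val a) (val b))).
exists (fun g a => subg P (baer_lambda (q g) (val a ^ (t g)^-1))).
exists (fun g => subg P (q g)).
have actP g a : g \in G -> a \in P -> baer_lambda (q g) (a ^ (t g)^-1) \in P.
  by move=> Gg Pa; rewrite baer_lambda_in ?Pq ?JP ?groupV ?Ht.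
split.
- by move=> a b; rewrite baer_addC ?subgP.
- move=> a b c /(congr1 val); rewrite !subgK ?baer_add_in ?subgP //.
  by move=> eq_bc; apply/val_inj/(baer_addI _ _ _ eq_bc); rewrite ?subgP.
- move=> a; apply: val_inj.
  by rewrite q1 t1 invg1 conjg1 baer_lambda1 subgK ?subgP.
- move=> g h Gg Gh a; congr (subg P _).
  rewrite subgK ?actP ?subgP // qM // tM // baer_lambdaJ invMg conjgM.
  by rewrite baer_lambdaM ?JP ?groupV ?Ht ?Pq ?subgP.
- move=> g h Gg Gh; congr (subg P _).
  by rewrite !subgK ?actP ?Pq // qM // baer_addM ?JP ?groupV ?Ht ?Pq.
- move=> a; have Ga : val a \in G by rewrite (subsetP (normal_sub nsPG)) ?subgP.
  exists (val a) => //; apply: val_inj.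
  by rewrite subgK ?Pq // /q divgr_id ?subgP.
- move=> g h Gg Gh; split=> [/(congr1 val) | Hgh].
    rewrite !subgK ?Pq // => eq_q.
    by rewrite (Eg g) (Eg h) eq_q invMg -mulgA mulKg groupM ?groupV ?Ht.
  congr (subg P _); have -> : h = q g * (t g * (g^-1 * h)).
    by rewrite mulgA -Eg mulKVg.
  apply/esym/(divgrMid tiPH (Pq g Gg)).
  by rewrite groupM // Ht.
Qed.
End Baer.

(** * Assembling the cocycles of the different primes *)

Lemma has_cocycle_quotient (gT : finGroupType) (G N : {group gT})
    (K : {group coset_of N}) :
  N <| G -> has_cocycle (G / N) K -> has_cocycle G (coset N @*^-1 K).
Proof.
case/andP=> _ nNG [M [add [act [pi [aC aI act1 actM piM piS piE]]]]].
have nN g : g \in G -> g \in 'N(N) by apply: (subsetP nNG).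
have GN g : g \in G -> coset N g \in G / N by move=> Gg; rewrite mem_quotient.
exists M, add, (fun g => act (coset N g)), (fun g => pi (coset N g)).
split=> //.
- by move=> m; rewrite morph1 act1.
- by move=> g h Gg Gh m; rewrite morphM ?nN //= actM ?GN.
- by move=> g h Gg Gh; rewrite morphM ?nN //= piM ?GN.
- by move=> m; have [_ /morphimP[g _ Gg ->] <-] := piS m; exists g.
- move=> g h Gg Gh.
  have nNgh : g^-1 * h \in 'N(N) by rewrite groupM ?groupV ?nN.
  rewrite in_setI nNgh inE morphM ?groupV ?nN // morphV ?nN //.
  by apply: piE; rewrite GN.
Qed.

(** The product of the two cocycles is onto because [K1 * K2 = G] lets the
    cosets of [K1] and of [K2] be prescribed independently. *)
Lemma has_cocycle_setI (gT : finGroupType) (G K1 K2 : {group gT}) :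
  K1 * K2 = G -> has_cocycle G K1 -> has_cocycle G K2 ->
  has_cocycle G (K1 :&: K2).
Proof.
move=> defG [M1 [add1 [act1 [pi1 [aC1 aI1 a11 aM1 pM1 pS1 pE1]]]]].
move=> [M2 [add2 [act2 [pi2 [aC2 aI2 a12 aM2 pM2 pS2 pE2]]]]].
exists (M1 * M2)%type, (fun a b => (add1 a.1 b.1, add2 a.2 b.2)).
exists (fun g a => (act1 g a.1, act2 g a.2)), (fun g => (pi1 g, pi2 g)).
split.
- by move=> a b; rewrite aC1 aC2.
- by move=> [a1 a2] [b1 b2] [c1 c2] [/aI1-> /aI2->].
- by move=> [m1 m2]; rewrite a11 a12.
- by move=> g h Gg Gh m; rewrite aM1 ?aM2.
- by move=> g h Gg Gh; rewrite pM1 ?pM2.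
- move=> [m1 m2]; have [g1 Gg1 <-] := pS1 m1; have [g2 Gg2 <-] := pS2 m2.
  have: g1^-1 * g2 \in K1 * K2 by rewrite defG groupM ?groupV.
  case/mulsgP=> k1 k2 Kk1 Kk2 Dk.
  have sK1G : K1 \subset G by rewrite -defG mulG_subl.
  have Gg : g1 * k1 \in G by rewrite groupM // (subsetP sK1G).
  exists (g1 * k1) => //; congr (_, _).
    by apply/esym/(pE1 _ _ Gg1 Gg); rewrite mulKg.
  by apply/(pE2 _ _ Gg Gg2); rewrite invMg -mulgA Dk mulKg.
- move=> g h Gg Gh; split=> [[/(pE1 _ _ Gg Gh) K1gh] | /setIP[]].
    by move/(pE2 _ _ Gg Gh) => K2gh; apply/setIP.
  by move=> /(pE1 _ _ Gg Gh)-> /(pE2 _ _ Gg Gh)->.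
Qed.

(** Modulo ['O_p^'(G)] the Sylow [p]-subgroup is normal, and a complement to
    it exists by the Schur-Zassenhaus theorem. *)
Lemma has_cocycle_p'Hall (gT : finGroupType) (G : {group gT}) p :
    solvable G -> class2_abelian2 G -> prime p ->
  exists2 K : {group gT}, p^'.-Hall(G) K & has_cocycle G K.
Proof.
move=> solG clG p_pr; set N := 'O_p^'(G).
have nsNG : N <| G := pcore_normal _ _.
have [P sylP] := Sylow_exists p (G / N); have [sPG pP p'iP] := and3P sylP.
have clGN := class2_abelian2_quotient nsNG clG.
have nsPG : P <| G / N.
  have <- : 'O_p(G / N) = P :> {set _}; last exact: pcore_normal.
  apply/eqP; rewrite eqEsubset (pcore_sub_Hall sylP).
  apply: sylow_sub_pcore => //; first exact: quotient_sol.
  exact: trivg_pcore_quotient.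
have [P'C abP] := clGN p P p_pr sPG pP.
have [k half] : exists k,
    {in P &, forall a b, [~ a, b] ^+ k * [~ a, b] ^+ k = [~ a, b]}.
  have [/abP abelP | p_odd] := even_prime p_pr.
    exists 0%N => a b Pa Pb; apply/esym; rewrite mul1g.
    by apply/eqP/commgP/(centsP abelP).
  (* 1/2 modulo the odd number #|P|. *)
  exists (#|P|.+1./2) => a b Pa Pb; rewrite -expgD addnn.
  have /= := odd_double_half #|P|.+1.
  rewrite (odd_pgroup_odd p_odd pP) add0n => ->.
  rewrite expgS (_ : _ ^+ #|P| = 1) ?mulg1 //.
  by apply/eqP; rewrite -order_dvdn order_dvdG ?groupR.
have hallP : Hall (G / N) P := pHall_Hall sylP.
have /splitsP[H /complP[tiPH defG]] := SchurZassenhaus_split hallP nsPG.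
have sdPH : P ><| H = G / N.
  by rewrite sdprodE // (subset_trans _ (normal_norm nsPG)) // -defG mulG_subr.
exists (coset N @*^-1 H)%G; last first.
  exact: has_cocycle_quotient nsNG (baer_cocycle P'C half sdPH).
have [_ nNG] := andP nsNG.
have sKG : coset N @*^-1 H \subset G.
  by rewrite sub_cosetpre_quo // -defG mulG_subr.
have oG : (#|G| = #|N| * (#|P| * #|H|))%N.
  rewrite -(Lagrange (normal_sub nsNG)) -card_quotient // -defG.
  by rewrite TI_cardMg.
have oK : (#|coset N @*^-1 H| = #|N| * #|H|)%N.
  have nNK : coset N @*^-1 H \subset 'N(N) := subset_trans sKG nNG.
  rewrite -(Lagrange (_ : N \subset _)) ?sub_cosetpre //.
  by rewrite -card_quotient // cosetpreK.
have iK : #|G : coset N @*^-1 H| = #|P|.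
  by rewrite -divgS // oG oK mulnCA mulnK // muln_gt0 !cardG_gt0.
have p'H : p^'.-group H.
  rewrite /pgroup; move: p'iP; rewrite -divgS //.
  by rewrite -defG TI_cardMg // mulKn.
apply/and3P; split=> //=; last by rewrite iK pnatNK.
by rewrite /pgroup oK pnatM; apply/andP; split; first exact: pcore_pgroup.
Qed.

(** The indices of the relevant Hall subgroups are coprime for different primes,
    so [has_cocycle_setI] applies prime after prime. *)
Lemma has_cocycle_pi'Hall (gT : finGroupType) (G : {group gT}) (s : seq nat) :
    solvable G -> class2_abelian2 G -> all prime s ->
  exists2 K : {group gT}, [predC s].-Hall(G) K & has_cocycle G K.
Proof.
move=> solG clG; elim: s => [_ | p s IHs /= /andP[p_pr pr_s]].
  exists G.
    rewrite /pHall subxx indexgg /= andbT /pgroup /pnat cardG_gt0.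
    by apply/allP=> q _; rewrite inE.
  exists unit, (fun _ _ => tt), (fun _ _ => tt), (fun _ => tt).
  split=> //; do ?by case.
  - by move=> _ [] [].
  - by case; exists 1.
  - by move=> g h Gg Gh; rewrite groupM ?groupV.
have [K hallK cocK] := IHs pr_s; have /and3P[sKG s'K sK] := hallK.
have [ps | ps] := boolP (p \in s).
  exists K => //; rewrite -(eq_pHall _ _ (_ : [predC s] =i _)) // => q.
  by rewrite !inE; case: eqP => // ->; rewrite ps.
have [L /and3P[sLG p'L pL] cocL] := has_cocycle_p'Hall solG clG p_pr.
have coKL : coprime #|G : K| #|G : L|.
  rewrite coprime_sym; apply: pnat_coprime sK; apply: sub_in_pnat pL => q _.
  by rewrite !inE negbK => /eqP->.
have defG := coprime_index_mulG sKG sLG coKL.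
exists (K :&: L)%G; last exact: has_cocycle_setI.
have eq_pi : [predC p :: s] =i [predI [predC s] & p^'].
  by move=> q; rewrite !inE negb_or andbC.
rewrite (eq_pHall _ _ eq_pi) /pHall subIset ?sKG //= /pgroup pnatI.
rewrite (pnat_dvd (cardSg (subsetIl K L)) s'K).
rewrite (pnat_dvd (cardSg (subsetIr K L)) p'L) /=.
have iKL : #|G : K :&: L| = (#|G : K| * #|G : L|)%N.
  have defG' : L * K = G by apply: coprime_index_mulG; rewrite // coprime_sym.
  rewrite -(Lagrange_index sKG (subsetIl K L)) indexgI; congr (_ * _)%N.
  by rewrite -defG' indexMg.
rewrite iKL pnatM; apply/andP; split.
  by apply: sub_in_pnat sK => q _; rewrite !inE negbK => ->.
apply: sub_in_pnat pL => q _; rewrite !inE negbK => /eqP->.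
by rewrite eqxx andbF.
Qed.

Theorem theorem2p6 (gT : finGroupType) (G : {group gT})
  (solG : solvable G)
  (evenG : 2 %| #|G|)
  (class2G : forall (p : nat) (P : {group gT}), prime p ->
     P \in 'Syl_p(G) -> nilpotent P /\ nil_class P <= 2)
  (abelian2G : forall P : {group gT}, P \in 'Syl_2(G) -> abelian P) :
  IYB_group G.
Proof.
have clG : class2_abelian2 G.
  move=> q S q_pr sSG qS.
  have [P sylP] := Sylow_exists q G; have [x Gx sSxP] := Sylow_Jsub sylP sSG qS.
  have sylP' : P \in 'Syl_q(G) by rewrite inE.
  move: sSxP; rewrite sub_conjg => sSP.
  split=> [|q2].
    apply: subset_trans (dergS 1 sSP) (subset_trans _ (centS sSP)).
    have [_] := class2G q P q_pr sylP'.
    by rewrite nil_class2 subsetI derJ centJ conjSg => /andP[].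
  by apply: abelianS sSP _; rewrite abelianJ; apply: abelian2G; rewrite -q2.
have [|K /and3P[sKG p'K _] cocK] :=
    has_cocycle_pi'Hall (s := primes #|G|) solG clG.
  by apply/allP=> q; rewrite mem_primes => /andP[].
have K1 : K = 1%G.
  apply/val_inj/card1_trivg/(@pnat_1 \pi(G)); last first.
    by apply: sub_in_pnat p'K => q _; rewrite !inE.
  exact: pnat_dvd (cardSg sKG) (pnat_pi (cardG_gt0 G)).
by move: cocK; rewrite K1 => -[M [add [act [pi]]]]; apply: cocycle_IYB.
Qed.
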